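(* Let $w=e^{2\pi i/6}$, let $a_1,\dots,a_5\in\mathbb{C}$ be constants, let $b_1,b_2,b_4,b_5,h_1,\dots,h_5$ be analytic functions of $t$ on a domain in $\mathbb{C}^*$, and put $b_3=0$, $x=z^{1/6}$. Let $D$ (a derivation over $z\frac{d}{dz}$) and $E$ (a derivation over $\frac{d}{dt}$) be the $\sigma$-equivariant operators on the free module with basis $e_0,\dots,e_5$ given by $$D(e_0)=\Big(x^2+\tfrac t6x-\tfrac5{12}\Big)e_0+\sum_{j=1}^5(a_j+b_jx)e_j,\qquad E(e_0)=x\,e_0+\sum_{j=1}^5h_je_j.$$ If $DE(e_0)=ED(e_0)$, then $$\begin{aligned} -18t\tfrac{db_1}{dt}={}&288b_1b_2b_4w-2b_1t^2w-24b_2b_5tw-288b_4^2b_5w+18a_1tw\\&-144b_1b_2b_4+b_1t^2+12b_2b_5t+144b_4^2b_5-18a_1t+216a_3b_4,\\ -6t\tfrac{db_2}{dt}={}&-4b_1^2tw+96b_1b_2b_5w-2b_2t^2w+12b_4^2tw-96b_4b_5^2w+6a_2tw\\&+2b_1^2t-48b_1b_2b_5+b_2t^2-6b_4^2t+48b_4b_5^2-12a_2t+72a_3b_5,\\ -6t\tfrac{db_4}{dt}={}&96b_1^2b_2w-96b_1b_4b_5w-12b_2^2tw+2b_4t^2w+4b_5^2tw-6a_4tw\\&-48b_1^2b_2+48b_1b_4b_5+6b_2^2t-b_4t^2-2b_5^2t+72a_3b_1-6a_4t,\\ -18t\tfrac{db_5}{dt}={}&288b_1b_2^2w+24b_1b_4tw-288b_2b_4b_5w+2b_5t^2w-18a_5tw\\&-144b_1b_2^2-12b_1b_4t+144b_2b_4b_5-b_5t^2+216a_3b_2.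 \end{aligned}$$ This system is Hamiltonian: it is equivalent to $$\tfrac{db_5}{dt}=-\tfrac{\partial H}{\partial b_1},\quad \tfrac{db_1}{dt}=\tfrac{\partial H}{\partial b_5},\quad \tfrac{db_4}{dt}=-\tfrac{\partial H}{\partial b_2},\quad \tfrac{db_2}{dt}=\tfrac{\partial H}{\partial b_4},$$ where $$\begin{aligned}3tH={}&(w-\tfrac12)\big(b_2b_4+\tfrac{b_1b_5}{3}\big)t^2+\Big((-2w+1)b_2^3+\big((2b_5^2-3a_4)w-b_5^2-3a_4\big)b_2+(1-2w)b_4^3\\&+\big((2b_1^2-3a_2)w-b_1^2+6a_2\big)b_4-(3a_1b_5+3a_5b_1)w+3a_1b_5\Big)t\\&+12(-b_1b_2+b_4b_5)\big(-b_1(2w-1)b_2+b_5(2w-1)b_4-3a_3\big).\end{aligned}$$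
   Context: The operators act on the free module with basis $e_0,\dots,e_5$ over the ring of Laurent polynomials in $x=z^{1/6}$ with coefficients analytic functions of $t$. $D$ is additive with $D(fm)=z\frac{\partial f}{\partial z}m+fD(m)$ (so $z\frac{\partial}{\partial z}x=\frac16x$), and $E$ is additive with $E(fm)=\frac{\partial f}{\partial t}m+fE(m)$. The semi-linear automorphism $\sigma$ is given by $\sigma(x)=wx$, $\sigma(t)=t$, $\sigma(e_j)=e_{j+1}$ with indices modulo 6; $\sigma$-equivariant means commuting with $\sigma$, so $D$ and $E$ are determined by $D(e_0)$ and $E(e_0)$. This is the case $n=6$ of the family with $z=0$ regular singular and eigenvalue (up to Galois conjugation and scaling of $t$) $z^{2/n}+tz^{1/n}$ at $z=\infty$. *)

(* Defs.v *)
From HB Require Import structures.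
From mathcomp Require Import all_boot all_order all_algebra.
From mathcomp Require Import complex.
From mathcomp Require Import all_classical all_reals all_analysis.
From mathcomp Require Import zify ring lra.
Set Implicit Arguments.
Unset Strict Implicit.
Unset Printing Implicit Defensive.
Import Order.TTheory GRing.Theory Num.Theory.
Import numFieldNormedType.Exports.
Local Open Scope classical_set_scope.
Local Open Scope ring_scope.

Section AnalyticAt.
Variable K : numFieldType.
Implicit Types (f g : K -> K) (a c : K).

(* f is the sum of a power series in a disc around a. *)
Definition analytic_at f a := exists r : K, exists c : nat -> K, 0 < r /\
  forall s, `|s - a| < r -> series (fun n => c n * (s - a) ^+ n) @ \oo --> f s.

Lemma near_analytic f g a : (exists2 r : K, 0 < r &
    forall s, `|s - a| < r -> f s = g s) -> analytic_at f a -> analytic_at g a.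
Proof.
move=> [r r0 fg] [q [c [q0 h]]].
have [m m0 [mr mq]] : exists2 m : K, 0 < m & m <= r /\ m <= q.
  have rr : r \is Num.real by rewrite realE ltW.
  have qr : q \is Num.real by rewrite realE ltW.
  case: (real_leP rr qr) => [rq|/ltW qr']; [by exists r|by exists q].
exists m, c; split => // s sm.
by rewrite -fg; [apply: h|]; apply: lt_le_trans sm _.
Qed.

Lemma analytic_poly2 f a c0 c1 :
  (forall s, f s = c0 + c1 * (s - a)) -> analytic_at f a.
Proof.
move=> fE; exists 1, (fun n => if n == 0%N then c0 else if n == 1%N then c1 else 0).
split => // s _; apply: cvg_near_cst; exists 2%N => // n /= n2.
rewrite /series /= big_mkord -(subnKC n2) !big_ord_recl /= big1 ?addr0; last first.
  by move=> i _; rewrite mul0r.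
by rewrite expr0 expr1 mulr1 fE.
Qed.

Lemma analytic_cst c a : analytic_at (fun=> c) a.
Proof. by apply: (@analytic_poly2 _ _ c 0) => s; rewrite mul0r addr0. Qed.

Lemma analytic_id a : analytic_at id a.
Proof. by apply: (@analytic_poly2 _ _ a 1) => s; rewrite mul1r addrC subrK. Qed.

Lemma analyticD f g a :
  analytic_at f a -> analytic_at g a -> analytic_at (fun s => f s + g s) a.
Proof.
move=> [r [c [r0 hf]]] [q [d [q0 hg]]].
have [m m0 [mr mq]] : exists2 m : K, 0 < m & m <= r /\ m <= q.
  have rr : r \is Num.real by rewrite realE ltW.
  have qr : q \is Num.real by rewrite realE ltW.
  case: (real_leP rr qr) => [rq|/ltW qr']; [by exists r|by exists q].
exists m, (fun n => c n + d n); split => // s sm.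
rewrite (_ : series _ = series (fun n => c n * (s - a) ^+ n) \+
                        series (fun n => d n * (s - a) ^+ n)).
  by apply: cvgD; [apply: hf|apply: hg]; apply: lt_le_trans sm _.
apply/funext => n; rewrite /series /= -big_split /=.
by apply: eq_bigr => i _; rewrite mulrDl.
Qed.

Lemma analyticN f a : analytic_at f a -> analytic_at (fun s => - f s) a.
Proof.
move=> [r [c [r0 hf]]]; exists r, (fun n => - c n); split => // s sr.
rewrite (_ : series _ = \- series (fun n => c n * (s - a) ^+ n)).
  by apply: cvgN; apply: hf.
apply/funext => n; rewrite /series /= -sumrN.
by apply: eq_bigr => i _; rewrite mulNr.
Qed.

Lemma pseries_term_bound (c : nat -> K) (r : K) : 0 < r ->
  cvgn (series (fun n => c n * r ^+ n)) ->
  exists2 B : K, 0 <= B & forall n s, `|s| < r / 8 -> `|c n * s ^+ n| <= B * 8 ^- n.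
Proof.
move=> r0 /cvg_series_cvg_0 cv0.
have /cvg_seq_bounded[M [Mr hM]] : cvgn (fun n => c n * r ^+ n).
  by apply/cvg_ex; exists 0.
exists (`|M| + 1); first by rewrite addr_ge0.
move=> n s sr.
have M1 : M < `|M| + 1.
  by rewrite (le_lt_trans (real_ler_norm Mr))// ltrDl ltr01.
have {hM}hM : `|c n * r ^+ n| <= `|M| + 1 by apply: hM.
have r8 : 0 <= r / 8 by rewrite divr_ge0 // ltW.
apply: (@le_trans _ _ (`|c n * r ^+ n| * 8 ^- n)); last first.
  by rewrite ler_wpM2r // invr_ge0 exprn_ge0.
rewrite !normrM -mulrA ler_wpM2l // !normrX (gtr0_norm r0) -exprVn -exprMn.
by apply: lerXn2r; rewrite ?nnegrE // ltW.
Qed.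

Lemma cauchy_prod_bound (x y : nat -> K) (B1 B2 : K) N : 0 <= B1 -> 0 <= B2 ->
  (forall n, `|x n| <= B1 * 8 ^- n) -> (forall n, `|y n| <= B2 * 8 ^- n) ->
  `|(\sum_(i < N) x i) * (\sum_(j < N) y j) -
    \sum_(n < N) \sum_(i < n.+1) x i * y (n - i)%N| <= (B1 * B2) * 2^-1 ^+ N.
Proof.
move=> B10 B20 hx hy.
have -> : \sum_(n < N) \sum_(i < n.+1) x i * y (n - i)%N =
    \sum_(i < N) \sum_(j < N | (i + j < N)%N) x i * y j.
  transitivity (\sum_(n < N) \sum_(i < N | (i <= n)%N) x i * y (n - i)%N).
    apply: eq_bigr => n _.
    by rewrite (big_ord_widen N (fun i => x i * y (n - i)%N)) //.
  rewrite (exchange_big_dep xpredT) //=; apply: eq_bigr => i _.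
  rewrite -(big_geq_mkord i N xpredT (fun n => x i * y (n - i)%N)).
  rewrite -{1}[nat_of_ord i]add0n big_addn big_mkord.
  rewrite (big_ord_widen N (fun j => x i * y (j + i - i)%N)) ?leq_subr //.
  by apply: eq_big => [j|j _]; [lia|rewrite addnK].
rewrite mulr_suml -sumrB.
have h8 n : 0 <= (8 ^- n : K) by rewrite invr_ge0 exprn_ge0.
have hN : forall i : 'I_N, `|x i * \sum_(j < N) y j -
    \sum_(j < N | (i + j < N)%N) x i * y j| <= (B1 * B2) * 8 ^- N *+ N.
  move=> i; rewrite mulr_sumr (bigID (fun j : 'I_N => (i + j < N)%N)) /= addrAC subrr add0r.
  apply: (le_trans (ler_norm_sum _ _ _)).
  rewrite -[X in _ *+ X](card_ord N) -sumr_const big_mkcond /=.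
  apply: ler_sum => j _; case: ifP => [|_]; last by rewrite !mulr_ge0.
  rewrite -leqNgt => Nij; rewrite normrM.
  apply: (le_trans (ler_pM (normr_ge0 _) (normr_ge0 _) (hx i) (hy j))).
  rewrite mulrACA ler_wpM2l ?mulr_ge0 // -invfM -exprD lef_pV2 ?posrE ?exprn_gt0 //.
  by rewrite ler_weXn2l // ler1n.
apply: (le_trans (ler_norm_sum _ _ _)).
apply: (@le_trans _ _ (\sum_(i < N) (B1 * B2) * 8 ^- N *+ N)); first exact: ler_sum.
rewrite sumr_const card_ord -mulrnA -mulrnAr ler_wpM2l ?mulr_ge0 //.
rewrite -[_ *+ _]mulr_natr exprVn ler_pdivrMl ?exprn_gt0 // -expr_div_n.
rewrite (_ : 8 / 2 = (2 * 2)%:R :> K); last by rewrite natrM; field.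
by rewrite -natrX ler_nat expnMn leq_mul // ltnW // ltn_expl.
Qed.

Lemma analyticM_of f g a : (fun n => (2^-1 : K) ^+ n) @ \oo --> (0 : K) ->
  analytic_at f a -> analytic_at g a -> analytic_at (fun s => f s * g s) a.
Proof.
move=> h2 [r [c [r0 hf]]] [q [d [q0 hg]]].
have [m m0 [mr mq]] : exists2 m : K, 0 < m & m < r /\ m < q.
  have rr : r \is Num.real by rewrite realE ltW.
  have qr : q \is Num.real by rewrite realE ltW.
  have half (x : K) : 0 < x -> x / 2 < x.
    by move=> x0; rewrite ltr_pdivrMr // ltr_pMr // ltr1n.
  case: (real_leP rr qr) => [rq|qr'].
    by exists (r / 2); rewrite ?divr_gt0 //; split; [|apply: lt_le_trans rq]; apply: half.
  by exists (q / 2); rewrite ?divr_gt0 //; split; [apply: lt_trans qr'|]; apply: half.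
have hm (k : nat -> K) (p : K) (F : K -> K) : m < p ->
    (forall s, `|s - a| < p -> series (fun n => k n * (s - a) ^+ n) @ \oo --> F s) ->
    cvgn (series (fun n => k n * m ^+ n)).
  move=> mp hF; apply/cvg_ex; exists (F (m + a)).
  by have := hF (m + a); rewrite addrK gtr0_norm //; apply.
have [B1 B10 hB1] := pseries_term_bound m0 (hm _ _ _ mr hf).
have [B2 B20 hB2] := pseries_term_bound m0 (hm _ _ _ mq hg).
exists (m / 8), (fun n => \sum_(i < n.+1) c i * d (n - i)%N).
split => [|s sm]; first by rewrite divr_gt0.
have sm' : `|s - a| < m.
  by apply: lt_le_trans sm _; rewrite ler_pdivrMr // ler_peMr ?ler1n // ltW.
have hx := hB1 ^~ (s - a) ^~ sm; have hy := hB2 ^~ (s - a) ^~ sm.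
have Hf := hf s (lt_trans sm' mr); have Hg := hg s (lt_trans sm' mq).
pose S (k : nat -> K) := series (fun n => k n * (s - a) ^+ n).
have key : (fun N => S c N * S d N -
    S (fun n => \sum_(i < n.+1) c i * d (n - i)%N) N) @ \oo --> (0 : K).
  apply/cvgr0Pnorm_lt => e e0.
  have eB : 0 < e / (B1 * B2 + 1).
    by rewrite divr_gt0 // ltr_wpDl ?mulr_ge0.
  have /cvgr0Pnorm_lt /(_ _ eB) := h2.
  apply: filterS => N.
  have B0 : 0 < B1 * B2 + 1 by rewrite ltr_wpDl ?mulr_ge0.
  rewrite ger0_norm ?exprn_ge0 ?invr_ge0 // ltr_pdivlMr // mulrC => lte.
  apply: le_lt_trans lte.
  have := cauchy_prod_bound N B10 B20 hx hy.
  rewrite /S /series /= !big_mkord => le1.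
  have -> : \sum_(n < N) (\sum_(i < n.+1) c i * d (n - i)%N) * (s - a) ^+ n =
      \sum_(n < N) \sum_(i < n.+1)
        c i * (s - a) ^+ i * (d (n - i)%N * (s - a) ^+ (n - i)).
    apply: eq_bigr => n _; rewrite mulr_suml; apply: eq_bigr => i _.
    by rewrite mulrACA -exprD subnKC // -ltnS.
  apply: le_trans le1 _; rewrite ler_wpM2r ?exprn_ge0 ?invr_ge0 //.
  by rewrite lerDl.
have -> : series (fun n => (\sum_(i < n.+1) c i * d (n - i)%N) * (s - a) ^+ n) =
   (fun N => S c N * S d N - (S c N * S d N -
    S (fun n => \sum_(i < n.+1) c i * d (n - i)%N) N)).
  by apply/funext => N; rewrite subKr.
rewrite -[X in _ --> X]subr0; apply: cvgB key.
by apply: cvgM.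
Qed.

End AnalyticAt.

(* R[i] has its topology and norm only when seen through numFieldType. *)
Definition Cplx (R : realType) : numFieldType := R[i]%C.

Section ComplexAnalytic.
Variable R : realType.
Notation C := (Cplx R).
Implicit Types (f g : C -> C) (a : C).

Lemma cvg_half_Cplx : (fun n => (2^-1 : C) ^+ n) @ \oo --> (0 : C).
Proof.
apply/cvgr0Pnorm_lt => e e0.
have e0' : 0 < e by [].
case: e e0' {e0} => x y; rewrite ltcE /= => /andP[/eqP -> x0].
have h1 : `|2^-1 : R| < 1 by rewrite ger0_norm ?invr_ge0 // invf_lt1 // ltr1n.
have /cvgr0Pnorm_lt /(_ _ x0) [N _ hN] := cvg_geometric 1 h1.
exists N => // n Nn; have := hN n Nn; rewrite /= mul1r => h.
have -> : (2^-1 : C) ^+ n = ((2^-1 : R) ^+ n)%:C%C.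
  by rewrite rmorphXn /= fmorphV /= rmorph_nat.
by rewrite normc_def /= expr0n /= addr0 sqrtr_sqr ltcR.
Qed.

Lemma analyticM f g a :
  analytic_at f a -> analytic_at g a -> analytic_at (fun s => f s * g s) a.
Proof. exact: analyticM_of cvg_half_Cplx. Qed.

End ComplexAnalytic.

Section AnalyticDerive.
Variable R : realType.
Notation C := (Cplx R).
Implicit Types (f g : C -> C) (a : C).

Lemma cvg_real_Cplx (u : nat -> R) (l : R) : u @ \oo --> l ->
  (fun n => (u n)%:C%C : C) @ \oo --> (l%:C%C : C).
Proof.
move=> /cvgrPdist_lt ul; apply/cvgrPdist_lt => e e0.
have e0' : 0 < e by [].
case: e e0' {e0} => x y; rewrite ltcE /= => /andP[/eqP -> x0].
have [N _ hN] := ul _ x0.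
exists N => // n Nn; have /= := hN n Nn => h.
rewrite -[X in `|X|](rmorphB (real_complex R)) normc_def /= expr0n /= addr0.
by rewrite sqrtr_sqr ltcR.
Qed.

Lemma series_real_cvg (x : nat -> R) (M : R) :
  (forall n, `|x n| <= M * 2^-1 ^+ n) -> cvgn (series x).
Proof.
move=> hx; apply: normed_cvg.
have M0 : 0 <= M by have := le_trans (normr_ge0 _) (hx 0%N); rewrite expr0 mulr1.
apply: (@series_le_cvg _ _ (geometric M 2^-1)) => //.
- by move=> n; apply: normr_ge0.
- by move=> n; rewrite /= mulr_ge0 ?exprn_ge0 ?invr_ge0.
- apply: is_cvg_geometric_series.
  by rewrite ger0_norm ?invr_ge0 // invf_lt1 // ltr1n.
Qed.

Lemma series_Cplx_cvg (x : nat -> C) (M : C) :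
  (forall n, `|x n| <= M * 2^-1 ^+ n) -> cvgn (series x).
Proof.
move=> hx.
have [N0 MN] : exists2 N : R, 0 <= N & M = N%:C%C.
  have := le_trans (normr_ge0 _) (hx 0%N); rewrite expr0 mulr1.
  case: (M) => p q; rewrite lecE /= => /andP[/eqP -> p0]; by exists p.
move=> eM; rewrite {M}eM in hx.
have hn n : Num.sqrt (complex.Re (x n) ^+ 2 + complex.Im (x n) ^+ 2) <= N0 * 2^-1 ^+ n.
  have := hx n; rewrite normc_def.
  have -> : (N0%:C%C * 2^-1 ^+ n : C) = (N0 * 2^-1 ^+ n)%:C%C.
    by rewrite rmorphM rmorphXn /= fmorphV /= rmorph_nat.
  by rewrite lecR.
have hr : cvgn (series (fun n => complex.Re (x n))).
  apply: (@series_real_cvg _ N0) => n; apply: le_trans (hn n).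
  by rewrite -sqrtr_sqr ler_wsqrtr // lerDl sqr_ge0.
have hi : cvgn (series (fun n => complex.Im (x n))).
  apply: (@series_real_cvg _ N0) => n; apply: le_trans (hn n).
  by rewrite -sqrtr_sqr ler_wsqrtr // lerDr sqr_ge0.
have /cvg_real_Cplx hr' := hr; have /cvg_real_Cplx hi' := hi.
have -> : series x = (fun n => ((series (fun n => complex.Re (x n)) n)%:C%C : C) +
    ('i%C : C) * ((series (fun n => complex.Im (x n)) n)%:C%C : C)).
  apply/funext => n; rewrite /series /= !rmorph_sum /= mulr_sumr -big_split /=.
  by apply: eq_bigr => i _; rewrite -complexE.
by apply/cvg_ex; eexists; apply: cvgD hr' _; apply: cvgM hi'; apply: cvg_cst.
Qed.

Lemma le_norm_lim (u : nat -> C) (l M : C) : 0 <= M ->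
  (forall n, `|u n| <= M) -> u @ \oo --> l -> `|l| <= M.
Proof.
move=> M0 hu /cvgrPdist_lt ul.
have [//|Ml] := real_leP (normr_real l) (ger0_real M0).
have [|N _ hN] := ul (`|l| - M); first by rewrite subr_gt0.
have /= := hN N (leqnn N); rewrite ltrBrDr => h.
have : `|l| < `|l|.
  apply: le_lt_trans h; rewrite -{1}(subrK (u N) l).
  by apply: le_trans (ler_normD _ _) _; rewrite lerD2l.
by rewrite ltxx.
Qed.

Lemma subX_bound (u v p : C) n : `|u| <= p -> `|v| <= p ->
  `|v ^+ n - u ^+ n| <= `|v - u| * (p ^+ n.-1 *+ n).
Proof.
move=> up vp; rewrite subrXX normrM ler_wpM2l //.
apply: le_trans (ler_norm_sum _ _ _) _.
rewrite -[X in _ *+ X](card_ord n) -sumr_const; apply: ler_sum => i _.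
rewrite normrM !normrX.
have ni : ((n.-1 - i) + i)%N = n.-1 by have := ltn_ord i; lia.
rewrite -[in X in _ <= X]ni exprD ler_pM ?exprn_ge0 //.
  by apply: lerXn2r => //; rewrite ?nnegrE ?(le_trans (normr_ge0 _) vp).
by apply: lerXn2r => //; rewrite ?nnegrE ?(le_trans (normr_ge0 _) up).
Qed.

Lemma subX_bound2 (u v p : C) n : `|u| <= p -> `|v| <= p ->
  `|v ^+ n - u ^+ n - (u ^+ n.-1 *+ n) * (v - u)| <=
  `|v - u| ^+ 2 * (p ^+ n.-2 *+ (n ^ 2)).
Proof.
move=> up vp.
have p0 : 0 <= p by apply: le_trans up.
have -> : v ^+ n - u ^+ n - (u ^+ n.-1 *+ n) * (v - u) =
    (v - u) * \sum_(i < n) (v ^+ (n.-1 - i) - u ^+ (n.-1 - i)) * u ^+ i.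
  rewrite subrXX [_ *+ n * _]mulrC -mulrBr; congr (_ * _).
  rewrite -[X in _ *+ X](card_ord n) -sumr_const -sumrB; apply: eq_bigr => i _.
  have in1 := ltn_ord i.
  rewrite mulrBl -exprD (_ : (n.-1 - i + i)%N = n.-1); last by lia.
  by [].
rewrite normrM expr2 -mulrA ler_wpM2l //.
apply: le_trans (ler_norm_sum _ _ _) _.
rewrite -mulnn mulrnA mulrnAr -[X in _ *+ X](card_ord n) -sumr_const.
apply: ler_sum => i _; rewrite normrM normrX.
have in1 := ltn_ord i.
apply: (@le_trans _ _ (`|v - u| * (p ^+ (n.-1 - i).-1 *+ (n.-1 - i)) * p ^+ i)).
  rewrite ler_pM ?exprn_ge0 //; first exact: subX_bound.
  by apply: lerXn2r => //; rewrite ?nnegrE ?(le_trans (normr_ge0 _) up).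
rewrite -mulrA ler_wpM2l // mulrnAl -exprD.
case: (posnP (n.-1 - i)%N) => [->|ni]; first by rewrite mulr0n mulrn_wge0 ?exprn_ge0.
rewrite (_ : ((n.-1 - i).-1 + i)%N = n.-2); last by lia.
by rewrite ler_wpMn2l ?exprn_ge0 //; lia.
Qed.

Lemma sqr8_le n : (8 ^- n *+ (n ^ 2) : C) <= 2^-1 ^+ n.
Proof.
rewrite -[_ *+ _]mulr_natr exprVn ler_pdivrMl ?exprn_gt0 // -expr_div_n.
rewrite (_ : 8 / 2 = (2 * 2)%:R :> C); last by rewrite natrM; field.
by rewrite -natrX ler_nat expnMn -mulnn leq_mul // ltnW // ltn_expl.
Qed.

Lemma sum_half_le n : \sum_(i < n) (2^-1 : C) ^+ i <= 2.
Proof.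
suff -> : \sum_(i < n) (2^-1 : C) ^+ i = 2 - 2 * 2^-1 ^+ n.
  by rewrite gerDl oppr_le0 mulr_ge0 // exprn_ge0 // invr_ge0.
elim: n => [|n IH]; first by rewrite big_ord0 expr0 mulr1 subrr.
by rewrite big_ord_recr /= IH exprS; field.
Qed.

Lemma le_add3 (x y z : C) : 0 <= x -> 0 <= y -> 0 <= z ->
  [/\ x <= x + y + z, y <= x + y + z & z <= x + y + z].
Proof.
move=> x0 y0 z0; split; last by rewrite lerDr addr_ge0.
  by rewrite -addrA lerDl addr_ge0.
by rewrite addrAC lerDr addr_ge0.
Qed.

Lemma analytic_derive f a : analytic_at f a -> exists (r : C) (e : nat -> C),
  0 < r /\ forall s, `|s - a| < r -> exists l : C,
    series (fun n => e n * (s - a) ^+ n) @ \oo --> l /\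
    h^-1 *: (f (h + s) - f s) @[h --> 0^'] --> l.
Proof.
move=> [r [c [r0 hf]]].
have [m m0 mr] : exists2 m : C, 0 < m & m < r.
  by exists (r / 2); rewrite ?divr_gt0 // ltr_pdivrMr // ltr_pMr // ltr1n.
have [p [p0 p8 pm]] : exists p : C, [/\ 0 < p, p < m / 8 & p < m].
  exists (m / 16); split; first by rewrite divr_gt0.
    by rewrite ltr_pM2l // ltf_pV2 ?posrE // ltr_nat.
  by rewrite ltr_pdivrMr // ltr_pMr // ltr1n.
have cm : cvgn (series (fun n => c n * m ^+ n)).
  apply/cvg_ex; exists (f (m + a)).
  by have := hf (m + a); rewrite addrK gtr0_norm //; apply.
have [B B0 hB] := pseries_term_bound m0 cm.
have {}hB n : `|c n| * p ^+ n <= B * 8 ^- n.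
  by have := hB n p; rewrite normrM normrX (gtr0_norm p0); apply.
pose M := 1 + p^-1 + p^-1 ^+ 2.
have pV0 : 0 <= p^-1 by rewrite invr_ge0 ltW.
have M0 : 0 <= M by rewrite !addr_ge0 ?exprn_ge0.
have [M1 M2 M3] : [/\ 1 <= M, p^-1 <= M & p^-1 ^+ 2 <= M].
  exact: le_add3 ler01 pV0 (exprn_ge0 2 pV0).
have pX n : 0 <= p ^+ n by rewrite exprn_ge0 // ltW.
have pK n : p ^+ n = p^-1 * p ^+ n.+1 by rewrite exprS mulKf // lt0r_neq0.
have hM2 n : p ^+ n.-1 <= M * p ^+ n.
  case: n => [|n] /=; first by rewrite expr0 mulr1.
  by rewrite [leLHS]pK ler_wpM2r.
have hM1 n : p ^+ n.-2 <= M * p ^+ n.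
  case: n => [|[|n]] //=; first by rewrite expr0 mulr1.
    by rewrite expr0 [leLHS](pK 0%N) ler_wpM2r.
  by rewrite [leLHS]pK [X in _ * X <= _]pK mulrA -expr2 ler_wpM2r.
have hc (q : nat -> nat) : (forall n, p ^+ q n <= M * p ^+ n) -> forall n,
    `|c n| * (p ^+ q n *+ (n ^ 2)) <= M * B * 2^-1 ^+ n.
  move=> hq n.
  apply: (@le_trans _ _ (`|c n| * (M * p ^+ n *+ (n ^ 2)))).
    by rewrite ler_wpM2l // lerMn2r hq orbT.
  rewrite -mulrnAr mulrCA -[M * B * _]mulrA ler_wpM2l // mulrnAr.
  apply: (@le_trans _ _ (B * 8 ^- n *+ (n ^ 2))); first by rewrite lerMn2r hB orbT.
  by rewrite -mulrnAr ler_wpM2l // sqr8_le.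
exists p, (fun n => c n.+1 *+ n.+1); split => // s sp.
set u := s - a in sp *.
pose x n := (c n * (u ^+ n.-1 *+ n)).
have hx n : `|x n| <= M * B * 2^-1 ^+ n.
  apply: le_trans (hc predn hM2 n).
  rewrite normrM ler_wpM2l // normrMn normrX.
  apply: (@le_trans _ _ (p ^+ n.-1 *+ n)).
    by rewrite lerMn2r; apply/orP; right; apply: lerXn2r; rewrite ?nnegrE // ltW.
  by rewrite (ler_wpMn2l (pX _)) // -mulnn; case: (n) => // k; rewrite leq_pmulr.
have /cvg_ex[l hl] := series_Cplx_cvg hx.
exists l; split.
  have -> : series (fun n => c n.+1 *+ n.+1 * u ^+ n) = (fun n => series x n.+1).
    apply/funext => n; rewrite /series /= big_nat_recl // {1}/x mulr0n mulr0 add0r.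
    by apply: eq_bigr => i _; rewrite /x /= mulrnAr mulrnAl.
  by rewrite (cvg_shiftS (series x)).
have key v : `|v| < p -> `|f (v + a) - f s - l * (v - u)| <= 2 * (M * B) * `|v - u| ^+ 2.
  move=> vp.
  pose y n := c n * v ^+ n - c n * u ^+ n - x n * (v - u).
  have hy : series y @ \oo --> f (v + a) - f s - l * (v - u).
    have -> : series y = (fun N => series (fun n => c n * v ^+ n) N -
        series (fun n => c n * u ^+ n) N - series x N * (v - u)).
      by apply/funext => N; rewrite /series /= /y !sumrB mulr_suml.
    have hv : series (fun n => c n * v ^+ n) @ \oo --> f (v + a).
      by have := hf (v + a); rewrite addrK; apply; apply: lt_trans vp (lt_trans pm mr).
    have hu : series (fun n => c n * u ^+ n) @ \oo --> f s.
      by apply: hf; apply: lt_trans sp (lt_trans pm mr).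
    have hk : (fun N => series x N * (v - u)) @ \oo --> l * (v - u).
      by apply: cvgM; [exact: hl|exact: cvg_cst].
    exact: cvgB (cvgB hv hu) hk.
  apply: le_norm_lim hy; first by rewrite !mulr_ge0 ?exprn_ge0.
  move=> N; rewrite /series /= big_mkord.
  apply: le_trans (ler_norm_sum _ _ _) _.
  apply: (@le_trans _ _ (\sum_(i < N) (M * B * `|v - u| ^+ 2) * 2^-1 ^+ i)).
    apply: ler_sum => i _.
    have -> : y i = c i * (v ^+ i - u ^+ i - (u ^+ i.-1 *+ i) * (v - u)).
      by rewrite /y /x [RHS]mulrBr [X in _ = X - _]mulrBr [X in _ = _ - X]mulrA.
    rewrite normrM.
    apply: (@le_trans _ _ (`|c i| * (`|v - u| ^+ 2 * (p ^+ i.-2 *+ (i ^ 2))))).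
      by rewrite ler_wpM2l // subX_bound2 ?(ltW sp) ?(ltW vp).
    rewrite [leLHS]mulrCA [leRHS]mulrAC [leRHS]mulrC ler_wpM2l ?exprn_ge0 //.
    exact: (hc (fun n => n.-2) hM1).
  rewrite -mulr_sumr [leLHS]mulrC -[leRHS]mulrA ler_wpM2r ?sum_half_le //.
  by rewrite !mulr_ge0 ?exprn_ge0.
apply/cvgrPdist_lt => e e0.
pose Q := 2 * (M * B) + 1.
have Q0 : 0 < Q by rewrite ltr_wpDl // !mulr_ge0.
have dp : 0 < p - `|u| by rewrite subr_gt0.
near=> h.
have h0 : h != 0 by near: h; exact: nbhs_dnbhs_neq.
have hd : `|h| < p - `|u|.
  near: h; apply: dnbhs0_lt; exact: dp.
have he : `|h| < e / Q by near: h; apply: dnbhs0_lt; rewrite divr_gt0.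
have us : u + a = s by rewrite subrK.
have := key (h + u); rewrite (addrK u h) -[h + u + a]addrA us.
have -> : `|h + u| < p.
  by apply: le_lt_trans (ler_normD _ _) _; rewrite -ltrBrDr.
move=> /(_ isT) kh.
rewrite -[X in `|X|]opprB normrN.
have -> : h^-1 *: (f (h + s) - f s) - l = h^-1 * (f (h + s) - f s - l * h).
  by rewrite mulrBr mulrCA mulVf // mulr1.
rewrite normrM normfV ltr_pdivrMl ?normr_gt0 //.
apply: le_lt_trans kh _; rewrite expr2 mulrCA ltr_pM2l ?normr_gt0 //.
move: he; rewrite ltr_pdivlMr // mulrC => he; apply: le_lt_trans he.
by rewrite ler_wpM2r // /Q lerDl.
Unshelve. all: by end_near. Qed.

Lemma analytic_derive1 f a : analytic_at f a -> analytic_at (derive1 f) a.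
Proof.
move=> /analytic_derive[r [e [r0 h]]]; exists r, e; split => // s /h[l [hl /cvg_lim hd]].
by rewrite /derive1 hd //; apply: norm_hausdorff.
Qed.

End AnalyticDerive.

Record domain (R : realType) := Domain {
  domain_set : set (Cplx R);
  domain_open : open domain_set;
  domain_connected : connected domain_set;
  domain_nonempty : domain_set !=set0;
  domain_neq0 : ~ domain_set 0 }.

(* An analytic function on U is represented by its extension by zero to C, so
   that Leibniz equality is equality on U. *)
Record anfun (R : realType) (U : domain R) := Anfun {
  anfun_val :> Cplx R -> Cplx R;
  anfun_analytic : forall t, domain_set U t -> analytic_at anfun_val t;
  anfun_out : forall t, ~ domain_set U t -> anfun_val t = 0 }.

Section AnfunRing.
Variables (R : realType) (U : domain R).
Notation C := (Cplx R).
Notation A := (anfun U).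

Lemma anfun_eqP (f g : A) : (forall t, domain_set U t -> f t = g t) -> f = g.
Proof.
move=> fg; have vfg : anfun_val f = g.
  apply/funext => t; have [/fg//|nUt] := pselect (domain_set U t).
  by rewrite !anfun_out.
case: f g vfg {fg} => f fa f0 [g ga g0] /= vfg; case: _ / vfg in ga g0 *.
by congr Anfun; apply: Prop_irrelevance.
Qed.

Lemma restrict_analytic (f : C -> C) :
  (forall t, domain_set U t -> analytic_at f t) ->
  forall t, domain_set U t ->
    analytic_at (fun s => if s \in domain_set U then f s else 0) t.
Proof.
move=> fa t Ut; apply: near_analytic (fa t Ut).
have /nbhs_ballP[r /= r0 rU] := @domain_open _ U t Ut.
exists r => // s sr; rewrite mem_set //.
by apply: rU; rewrite /ball /= distrC.
Qed.

Lemma restrict_out (f : C -> C) t : ~ domain_set U t ->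
  (if t \in domain_set U then f t else 0) = 0.
Proof. by move=> nUt; rewrite memNset. Qed.

Definition restr_anfun (f : C -> C)
    (fa : forall t, domain_set U t -> analytic_at f t) : A :=
  Anfun (restrict_analytic fa) (@restrict_out f).

Lemma restr_anfunE f fa t : domain_set U t -> @restr_anfun f fa t = f t.
Proof. by move=> Ut; rewrite /= mem_set. Qed.

Definition cst_anfun (c : C) : A := restr_anfun (fun t _ => analytic_cst c t).
Definition var_anfun : A := restr_anfun (fun t _ => analytic_id t).

Definition add_anfun (f g : A) : A :=
  restr_anfun (fun t Ut => analyticD (anfun_analytic f Ut) (anfun_analytic g Ut)).
Definition opp_anfun (f : A) : A :=
  restr_anfun (fun t Ut => analyticN (anfun_analytic f Ut)).
Definition mul_anfun (f g : A) : A :=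
  restr_anfun (fun t Ut => analyticM (anfun_analytic f Ut) (anfun_analytic g Ut)).

Definition derive_anfun (f : A) : A :=
  restr_anfun (fun t Ut => analytic_derive1 (anfun_analytic f Ut)).

HB.instance Definition _ := gen_eqMixin A.
HB.instance Definition _ := gen_choiceMixin A.

Fact add_anfunA : associative add_anfun.
Proof. by move=> f g h; apply: anfun_eqP => t Ut; rewrite !restr_anfunE // addrA. Qed.
Fact add_anfunC : commutative add_anfun.
Proof. by move=> f g; apply: anfun_eqP => t Ut; rewrite !restr_anfunE // addrC. Qed.
Fact add_0anfun : left_id (cst_anfun 0) add_anfun.
Proof. by move=> f; apply: anfun_eqP => t Ut; rewrite !restr_anfunE // add0r. Qed.
Fact add_Nanfun : left_inverse (cst_anfun 0) opp_anfun add_anfun.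
Proof. by move=> f; apply: anfun_eqP => t Ut; rewrite !restr_anfunE // addNr. Qed.
HB.instance Definition _ :=
  GRing.isZmodule.Build A add_anfunA add_anfunC add_0anfun add_Nanfun.

Fact mul_anfunA : associative mul_anfun.
Proof. by move=> f g h; apply: anfun_eqP => t Ut; rewrite !restr_anfunE // mulrA. Qed.
Fact mul_anfunC : commutative mul_anfun.
Proof. by move=> f g; apply: anfun_eqP => t Ut; rewrite !restr_anfunE // mulrC. Qed.
Fact mul_1anfun : left_id (cst_anfun 1) mul_anfun.
Proof. by move=> f; apply: anfun_eqP => t Ut; rewrite !restr_anfunE // mul1r. Qed.
Fact mul_anfunDl : left_distributive mul_anfun +%R.
Proof.
by move=> f g h; apply: anfun_eqP => t Ut; rewrite !restr_anfunE // mulrDl.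
Qed.
Fact anfun1_neq0 : cst_anfun 1 != 0.
Proof.
apply/eqP => e; have [t Ut] := @domain_nonempty _ U.
have : cst_anfun 1 t = cst_anfun 0 t by rewrite e.
by rewrite !restr_anfunE // => /eqP; rewrite oner_eq0.
Qed.
HB.instance Definition _ := GRing.Zmodule_isComNzRing.Build A
  mul_anfunA mul_anfunC mul_1anfun mul_anfunDl anfun1_neq0.

Lemma derive_anfun0 : derive_anfun 0 = 0.
Proof.
apply: anfun_eqP => t Ut; rewrite !restr_anfunE //.
rewrite [X in derive1 X](_ : _ = cst 0) ?derive1_cst //.
by apply/funext => s; rewrite /=; case: ifP.
Qed.

End AnfunRing.

(* Laurent polynomials \sum_k f_k x^k, as finitely supported families of
   coefficients. *)
Record laurent (A : comNzRingType) := Laurent {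
  lcoef :> int -> A;
  lcoef_fin : exists n : nat, forall k : int, (n < `|k|)%N -> lcoef k = 0 }.

Section LaurentRing.
Variable A : comNzRingType.
Notation L := (laurent A).
Implicit Types (f g h : int -> A).

Definition lbound n f := forall k : int, (n < `|k|)%N -> f k = 0.

Definition lconv f g (k : int) : A := \sum_(i \in [set: int]) f i * g (k - i).

Definition lpoly n f : {poly A} := \poly_(m < n.*2.+1) f (m%:Z - n%:Z).

Lemma lboundW n m f : (n <= m)%N -> lbound n f -> lbound m f.
Proof. by move=> nm hf k mk; apply: hf; apply: leq_ltn_trans mk. Qed.

Lemma lpolyE n f m : lbound n f -> (lpoly n f)`_m = f (m%:Z - n%:Z).
Proof.
by move=> hf; rewrite coef_poly; case: ltnP => // nm; rewrite hf //; lia.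
Qed.

Lemma lpoly_inj n f g : lbound n f -> lbound n g -> lpoly n f = lpoly n g -> f = g.
Proof.
move=> hf hg /polyP e; apply/funext => k.
have [nk|kn] := ltnP n `|k|%N; first by rewrite hf // hg.
have := e `|(k + n%:Z)%R|%N; rewrite !lpolyE //.
by have -> : `|(k + n%:Z)%R|%N%:Z - n%:Z = k by lia.
Qed.

Lemma lconv_bound n m f g : lbound n f -> lbound m g -> lbound (n + m) (lconv f g).
Proof.
move=> hf hg k nmk; rewrite /lconv fsbig1 // => i _.
have [ni|ni] := ltnP n `|i|%N; first by rewrite hf // mul0r.
by rewrite [g _]hg ?mulr0 //; lia.
Qed.

Lemma lpoly_conv n m f g : lbound n f -> lbound m g ->
  lpoly (n + m) (lconv f g) = lpoly n f * lpoly m g.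
Proof.
move=> hf hg; apply/polyP => k; rewrite lpolyE; last exact: lconv_bound.
rewrite coefM /lconv.
have -> : \sum_(j < k.+1) (lpoly n f)`_j * (lpoly m g)`_(k - j) =
    \sum_(j < k.+1) f (j%:Z - n%:Z) * g ((k - j)%N%:Z - m%:Z).
  by apply: eq_bigr => j _; rewrite !lpolyE.
rewrite (fsbig_ord _ _ (fun j => f (j%:Z - n%:Z) * g ((k - j)%N%:Z - m%:Z))).
rewrite -(@fsbig_widen _ _ _ _ ((fun j : nat => j%:Z - n%:Z) @` `I_k.+1)) //; last first.
  move=> i /= [_ iN].
  have [ni|ni] := ltnP n `|i|%N; first by rewrite hf // mul0r.
  have [mi|mi] := ltnP m `|(k%:Z - (n + m)%:Z - i)%R|%N; first by rewrite [g _]hg ?mulr0.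
  by case: iN; exists (absz (i + n%:Z)); rewrite /=; lia.
rewrite fsbig_image; last by move=> i j _ _ /= e; lia.
by apply: eq_fsbigr => j /set_mem /= jk; congr (_ * g _); lia.
Qed.

Definition lmono (c : A) (n : int) (k : int) : A := if k == n then c else 0.

Lemma lmono_bound c n : lbound `|n| (lmono c n).
Proof. by move=> k; rewrite /lmono; case: eqP => // ->; lia. Qed.

HB.instance Definition _ := gen_eqMixin L.
HB.instance Definition _ := gen_choiceMixin L.

Lemma laurent_eqP (f g : L) : (forall k, f k = g k) -> f = g.
Proof.
move=> fg; have vfg : lcoef f = g by apply/funext.
case: f g vfg {fg} => f fa [g ga] /= vfg; case: _ / vfg in ga *.
by congr Laurent; apply: Prop_irrelevance.
Qed.

Fact laurent_addP (f g : L) : exists n, lbound n (fun k => f k + g k).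
Proof.
case: f g => f [n hf] [g [m hg]]; exists (n + m)%N => k nmk /=.
by rewrite hf ?hg ?addr0 //; lia.
Qed.
Fact laurent_oppP (f : L) : exists n, lbound n (fun k => - f k).
Proof. by case: f => f [n hf]; exists n => k nk /=; rewrite hf ?oppr0. Qed.
Fact laurent_mulP (f g : L) : exists n, lbound n (lconv f g).
Proof. by case: f g => f [n hf] [g [m hg]]; exists (n + m)%N; apply: lconv_bound. Qed.
Fact laurent_monoP c n : exists m, lbound m (lmono c n).
Proof. by exists `|n|%N; apply: lmono_bound. Qed.

Definition laurent_add (f g : L) : L := Laurent (laurent_addP f g).
Definition laurent_opp (f : L) : L := Laurent (laurent_oppP f).
Definition laurent_mul (f g : L) : L := Laurent (laurent_mulP f g).
(* The monomial c x^n. *)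
Definition laurent_mono c n : L := Laurent (laurent_monoP c n).

Fact laurent_addA : associative laurent_add.
Proof. by move=> f g h; apply: laurent_eqP => k /=; rewrite addrA. Qed.
Fact laurent_addC : commutative laurent_add.
Proof. by move=> f g; apply: laurent_eqP => k /=; rewrite addrC. Qed.
Fact laurent_add0 : left_id (laurent_mono 0 0) laurent_add.
Proof. by move=> f; apply: laurent_eqP => k /=; rewrite /lmono if_same add0r. Qed.
Fact laurent_addN : left_inverse (laurent_mono 0 0) laurent_opp laurent_add.
Proof. by move=> f; apply: laurent_eqP => k /=; rewrite /lmono if_same addNr. Qed.
HB.instance Definition _ := GRing.isZmodule.Build L
  laurent_addA laurent_addC laurent_add0 laurent_addN.

Fact laurent_mulA : associative laurent_mul.
Proof.
case=> f [n hf] [g [m hg]] [h [p hh]]; apply: laurent_eqP => /= k.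
congr (_ k); apply: (@lpoly_inj (n + (m + p))).
- by apply: lconv_bound hf _; apply: lconv_bound.
- by rewrite addnA; apply: lconv_bound hh; apply: lconv_bound.
- have hfg := lconv_bound hf hg; have hgh := lconv_bound hg hh.
  by rewrite (lpoly_conv hf hgh) (lpoly_conv hg hh) addnA
    (lpoly_conv hfg hh) (lpoly_conv hf hg) mulrA.
Qed.
Fact laurent_mulC : commutative laurent_mul.
Proof.
case=> f [n hf] [g [m hg]]; apply: laurent_eqP => /= k.
congr (_ k); apply: (@lpoly_inj (n + m)); first exact: lconv_bound.
  by rewrite addnC; apply: lconv_bound.
by rewrite lpoly_conv // addnC lpoly_conv // mulrC.
Qed.
Fact laurent_mul1 : left_id (laurent_mono 1 0) laurent_mul.
Proof.
case=> f [n hf]; apply: laurent_eqP => /= k; rewrite /lconv.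
rewrite -(@fsbig_widen _ _ _ _ [set 0]) //; last first.
  by move=> i /= [_ /eqP]; rewrite /lmono => /negPf ->; rewrite mul0r.
by rewrite fsbig_set1 /lmono eqxx mul1r subr0.
Qed.
Fact laurent_mulDl : left_distributive laurent_mul +%R.
Proof.
case=> f [n hf] [g [m hg]] [h [p hh]]; apply: laurent_eqP => /= k.
set N := (n + m)%N.
have hfN : lbound N f by apply: lboundW hf; rewrite leq_addr.
have hgN : lbound N g by apply: lboundW hg; rewrite leq_addl.
have hfgN : lbound N (fun k => f k + g k).
  by move=> i Ni; rewrite hfN // hgN // addr0.
suff -> : lconv (fun k => f k + g k) h = (fun k => lconv f h k + lconv g h k) by [].
have lD M u v : lpoly M (fun k => u k + v k) = lpoly M u + lpoly M v.
  by apply/polyP => i; rewrite coefD !coef_poly; case: ifP; rewrite ?addr0.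
apply: (@lpoly_inj (N + p)); first exact: (lconv_bound hfgN hh).
  by move=> i Ni; rewrite (lconv_bound hfN hh Ni) (lconv_bound hgN hh Ni) addr0.
rewrite lD (lpoly_conv hfN hh) (lpoly_conv hgN hh) -mulrDl -lD.
exact: (lpoly_conv hfgN hh).
Qed.
Fact laurent1_neq0 : laurent_mono 1 0 != 0.
Proof.
apply/eqP => /(congr1 (fun f : L => f 0)) /eqP.
by rewrite /= /lmono eqxx oner_eq0.
Qed.
HB.instance Definition _ := GRing.Zmodule_isComNzRing.Build L
  laurent_mulA laurent_mulC laurent_mul1 laurent_mulDl laurent1_neq0.

End LaurentRing.

Section Operators.
Variables (R : realType) (U : domain R).
Notation C := (Cplx R).
Notation A := (anfun U).
Notation L := (laurent (anfun U)).

Definition laurent_cst (f : A) : L := laurent_mono f 0.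
Definition laurent_X : L := laurent_mono 1 1.

Fact laurent_coef_mapP (d : int -> A -> A) (f : L) : (forall k, d k 0 = 0) ->
  exists n : nat, forall k : int, (n < `|k|)%N -> d k (f k) = 0.
Proof. by move=> d0; case: f => f [n hf]; exists n => k nk /=; rewrite hf. Qed.

(* e^(2 pi i / 6) *)
Definition w6 : C := (cos (2 * pi / 6) +i* sin (2 * pi / 6))%C.

(* z d/dz, where x = z^(1/6), so that z d/dz (x^k) = (k / 6) x^k. *)
Definition laurent_zddz (f : L) : L :=
  Laurent (@laurent_coef_mapP (fun k c => cst_anfun U (k%:~R / 6) * c) f
    (fun k => mulr0 _)).

Definition laurent_ddt (f : L) : L :=
  Laurent (@laurent_coef_mapP (fun=> @derive_anfun R U) f
    (fun=> derive_anfun0 U)).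

(* The automorphism of the ring L fixing the coefficients and mapping x to w6 x. *)
Definition laurent_sigma (f : L) : L :=
  Laurent (@laurent_coef_mapP (fun k c => cst_anfun U (w6 ^ k) * c) f
    (fun k => mulr0 _)).

Definition basis_e (j : 'I_6) : 'rV[L]_6 := delta_mx 0 j.

(* The semi-linear automorphism mapping e_j to e_(j+1); addition in 'I_6 is
   modulo 6. *)
Definition sigma (m : 'rV[L]_6) : 'rV[L]_6 :=
  \sum_(j < 6) laurent_sigma (m 0 j) *: basis_e (j + 1).

Record equivariant_derivation (d : L -> L) (D : 'rV[L]_6 -> 'rV[L]_6) : Prop := {
  derivationD : {morph D : m1 m2 / m1 + m2};
  derivation_leibniz : forall f m, D (f *: m) = d f *: m + f *: D m;
  derivation_sigma : forall m, D (sigma m) = sigma (D m) }.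

End Operators.

Section Equations.
Variable R : realType.
Notation C := (Cplx R).
Variables a1 a2 a3 a4 a5 : C.
Notation w := (w6 R).

Definition ode_system (b1 b2 b4 b5 : C -> C) (t : C) : Prop :=
  let db1 := derive1 b1 t in let db2 := derive1 b2 t in
  let db4 := derive1 b4 t in let db5 := derive1 b5 t in
  let b1 := b1 t in let b2 := b2 t in let b4 := b4 t in let b5 := b5 t in
  [/\ - 18 * t * db1 =
        288 * b1 * b2 * b4 * w - 2 * b1 * t ^+ 2 * w - 24 * b2 * b5 * t * w
        - 288 * b4 ^+ 2 * b5 * w + 18 * a1 * t * w - 144 * b1 * b2 * b4
        + b1 * t ^+ 2 + 12 * b2 * b5 * t + 144 * b4 ^+ 2 * b5 - 18 * a1 * t
        + 216 * a3 * b4,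
      - 6 * t * db2 =
        - 4 * b1 ^+ 2 * t * w + 96 * b1 * b2 * b5 * w - 2 * b2 * t ^+ 2 * w
        + 12 * b4 ^+ 2 * t * w - 96 * b4 * b5 ^+ 2 * w + 6 * a2 * t * w
        + 2 * b1 ^+ 2 * t - 48 * b1 * b2 * b5 + b2 * t ^+ 2 - 6 * b4 ^+ 2 * t
        + 48 * b4 * b5 ^+ 2 - 12 * a2 * t + 72 * a3 * b5,
      - 6 * t * db4 =
        96 * b1 ^+ 2 * b2 * w - 96 * b1 * b4 * b5 * w - 12 * b2 ^+ 2 * t * w
        + 2 * b4 * t ^+ 2 * w + 4 * b5 ^+ 2 * t * w - 6 * a4 * t * w
        - 48 * b1 ^+ 2 * b2 + 48 * b1 * b4 * b5 + 6 * b2 ^+ 2 * t - b4 * t ^+ 2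
        - 2 * b5 ^+ 2 * t + 72 * a3 * b1 - 6 * a4 * t
    & - 18 * t * db5 =
        288 * b1 * b2 ^+ 2 * w + 24 * b1 * b4 * t * w - 288 * b2 * b4 * b5 * w
        + 2 * b5 * t ^+ 2 * w - 18 * a5 * t * w - 144 * b1 * b2 ^+ 2
        - 12 * b1 * b4 * t + 144 * b2 * b4 * b5 - b5 * t ^+ 2 + 216 * a3 * b2].

Definition hamiltonian (t b1 b2 b4 b5 : C) : C :=
  ((w - 1 / 2) * (b2 * b4 + b1 * b5 / 3) * t ^+ 2
   + ((- 2 * w + 1) * b2 ^+ 3
      + ((2 * b5 ^+ 2 - 3 * a4) * w - b5 ^+ 2 - 3 * a4) * b2
      + (1 - 2 * w) * b4 ^+ 3
      + ((2 * b1 ^+ 2 - 3 * a2) * w - b1 ^+ 2 + 6 * a2) * b4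
      - (3 * a1 * b5 + 3 * a5 * b1) * w + 3 * a1 * b5) * t
   + 12 * (- b1 * b2 + b4 * b5)
     * (- b1 * (2 * w - 1) * b2 + b5 * (2 * w - 1) * b4 - 3 * a3))
  / (3 * t).

Definition hamilton_equations (b1 b2 b4 b5 : C -> C) (t : C) : Prop :=
  let H := hamiltonian t in
  [/\ derive1 b5 t = - derive1 (fun y => H y (b2 t) (b4 t) (b5 t)) (b1 t),
      derive1 b1 t = derive1 (fun y => H (b1 t) (b2 t) (b4 t) y) (b5 t),
      derive1 b4 t = - derive1 (fun y => H (b1 t) y (b4 t) (b5 t)) (b2 t)
    & derive1 b2 t = derive1 (fun y => H (b1 t) (b2 t) y (b5 t)) (b4 t)].

End Equations.

(* Main.v *)
(* Equivariance under [sigma] makes [D] and [E] determined by their values on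
   [e 0], so that [D (E (e 0)) = E (D (e 0))] amounts to equations between
   Laurent polynomials, one for each basis vector. The x^2-coefficients at
   [e k] express [h k] for [k = 1, 2, 4, 5] through [b k]; the x-coefficient at
   [e 3] then gives [h 3], and the x-coefficients at the remaining [e k] are the
   differential equations. The Hamiltonian is a polynomial of degree at most 3 in
   each b_i, so its partial derivatives are read off the coefficients. *)
Require Import Defs.
From HB Require Import structures.
From mathcomp Require Import all_boot all_order all_algebra.
From mathcomp Require Import complex.
From mathcomp Require Import all_classical all_reals all_analysis.
From mathcomp Require Import ring.
Set Implicit Arguments.
Unset Strict Implicit.
Unset Printing Implicit Defensive.
Import Order.TTheory GRing.Theory Num.Theory.
Import numFieldNormedType.Exports.
Local Open Scope classical_set_scope.
Local Open Scope ring_scope.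

(** * Linear certificates and the sixth root of unity *)

(** Deduces an equation from a known one by an explicit cofactor [c]; what remains is an identity
    for [ring] or [field]. *)
Lemma eq_of_multiple (R : pzRingType) (c l r x y : R) :
  l = r -> x - y = c * (l - r) -> x = y.
Proof. by move=> ->; rewrite subrr mulr0 => /eqP; rewrite subr_eq0 => /eqP. Qed.

(** Serves with [x] a derivative of some b_i, [y] the matching signed partial derivative of H, and
    [v] the right-hand side of the differential equation. *)
Lemma mulf_eq_iff (F : fieldType) (u v x y : F) :
  u != 0 -> u * y = v -> u * x = v <-> x = y.
Proof. by move=> u0 <-; split=> [/(mulfI u0)|->]. Qed.

Lemma w6_sqr (R : realType) : w6 R ^+ 2 = w6 R - 1.
Proof.
rewrite /w6; have -> : 2 * pi / 6 = pi / 3 :> R by field.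
set th := pi / 3; have pi0 := pi_gt0 R.
have s0 : 0 < sin th.
  by apply: sin_gt0_pi; rewrite divr_gt0 //= ltr_pdivrMr // ltr_pMr // ltr1n.
have sc := cos2Dsin2 th.
(* cos (3 th) = -1 is a cubic equation in cos th, with the roots -1 and 1/2. *)
have c3 : cos (th *+ 2 + th) = -1.
  by rewrite -cospi; congr cos; rewrite /th; field.
have c2 : (cos th + 1) * (2 * cos th - 1) ^+ 2 = 0.
  rewrite cosD cos_mulr2n sin_mulr2n in c3.
  have s2 : sin th ^+ 2 = 1 - cos th ^+ 2 by rewrite -sc; ring.
  by apply: (eq_of_multiple (c := 1) c3); ring: s2.
have {}c2 : cos th = 1 / 2.
  (* The root -1 would force sin th = 0, against [s0]. *)
  have /eqP := c2; rewrite mulf_eq0 sqrf_eq0 => /orP[]/eqP c.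
    have cN : cos th = -1 by apply: (eq_of_multiple (c := 1) c); ring.
    have : sin th ^+ 2 = 0.
      by apply: (eq_of_multiple (c := 1) sc); rewrite cN; ring.
    by move/eqP; rewrite sqrf_eq0 gt_eqF.
  by apply: (eq_of_multiple (c := 1 / 2) c); field.
have s2 : sin th ^+ 2 = 3 / 4.
  by apply: (eq_of_multiple (c := 1) sc); rewrite c2; field.
rewrite c2 expr2; apply/eqP; rewrite eq_complex /=; apply/andP.
split; apply/eqP; last by field.
by rewrite -[sin th * _]/(sin th ^+ 2) s2; field.
Qed.

(** * Sums over 'I_6 *)

(** The predicate becomes conditionals on literals, so that conditions such as j != k are decided by
    computation. *)
Lemma big_I6 (V : nmodType) (P : pred 'I_6) (F : 'I_6 -> V) :
  \sum_(j < 6 | P j) F j =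
    (if P 0 then F 0 else 0) + (if P 1 then F 1 else 0)
    + (if P 2 then F 2 else 0) + (if P 3 then F 3 else 0)
    + (if P 4 then F 4 else 0) + (if P 5 then F 5 else 0).
Proof.
have enum6 : index_enum 'I_6 = [:: 0; 1; 2; 3; 4; 5].
  rewrite [index_enum _]unlock -enumT; apply: (inj_map val_inj).
  by rewrite val_enum_ord.
by rewrite big_mkcond enum6 !big_cons big_nil /= addr0 !addrA.
Qed.

(** Rewriting table that turns the indices k - j, taken modulo 6, into literals. *)
Lemma subI6 :
  ((1 - 2 = 5 :> 'I_6) * (1 - 3 = 4 :> 'I_6) * (1 - 4 = 3 :> 'I_6) *
   (1 - 5 = 2 :> 'I_6) * (2 - 1 = 1 :> 'I_6) * (2 - 3 = 5 :> 'I_6) *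
   (2 - 4 = 4 :> 'I_6) * (2 - 5 = 3 :> 'I_6) * (3 - 1 = 2 :> 'I_6) *
   (3 - 2 = 1 :> 'I_6) * (3 - 4 = 5 :> 'I_6) * (3 - 5 = 4 :> 'I_6) *
   (4 - 1 = 3 :> 'I_6) * (4 - 2 = 2 :> 'I_6) * (4 - 3 = 1 :> 'I_6) *
   (4 - 5 = 5 :> 'I_6) * (5 - 1 = 4 :> 'I_6) * (5 - 2 = 3 :> 'I_6) *
   (5 - 3 = 2 :> 'I_6) * (5 - 4 = 1 :> 'I_6))%type.
Proof. by do ?split; apply: val_inj. Qed.

Lemma valI6 :
  (((1 : 'I_6) = 1%N :> nat) * ((2 : 'I_6) = 2%N :> nat) *
   ((3 : 'I_6) = 3%N :> nat) * ((4 : 'I_6) = 4%N :> nat) *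
   ((5 : 'I_6) = 5%N :> nat))%type.
Proof. by []. Qed.

(** * Elimination of the h_k *)

Section Elimination.
Variables (F : numFieldType) (w t : F) (a b h db : 'I_6 -> F).
Hypotheses (w2 : w ^+ 2 = w - 1) (b3 : b 3 = 0) (db3 : db 3 = 0).
Hypothesis coefX2 : forall k : 'I_6, k != 0 ->
  b k + h k * (w ^+ 2) ^+ k = h k + b k * w ^+ k.
Hypothesis coefX1 : forall k : 'I_6, k != 0 ->
  a k + h k * (w ^+ k * (1 / 6 * t))
    + \sum_(j < 6 | (j != 0) && (j != k)) h j * (w ^+ j * b (k - j))
  = db k + 1 / 6 * t * h k + a k * w ^+ k
    + \sum_(j < 6 | (j != 0) && (j != k)) b j * h (k - j).

(** [coefX2] reads h k (w^(2k) - 1) = b k (w^k - 1), so h k = b k / (w^k + 1) for k = 1, 2, 4, 5.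
    Here and below, the inverse is written as a polynomial in w by means of [w2], and so is the
    cofactor 1 / (w^(2k) - 1). At k = 3 the factor w^6 - 1 vanishes. *)
Let h1E : h 1 = b 1 * (2 - w) / 3.
Proof.
apply: (eq_of_multiple (c := (- 1 - w) / 3) (coefX2 (k := 1) isT)).
by rewrite valI6; field: w2.
Qed.

Let h2E : h 2 = b 2 * (1 - w).
Proof.
apply: (eq_of_multiple (c := (w - 2) / 3) (coefX2 (k := 2) isT)).
by rewrite valI6; field: w2.
Qed.

Let h4E : h 4 = b 4 * w.
Proof.
apply: (eq_of_multiple (c := (- 1 - w) / 3) (coefX2 (k := 4) isT)).
by rewrite valI6; field: w2.
Qed.

Let h5E : h 5 = b 5 * (1 + w) / 3.
Proof.
apply: (eq_of_multiple (c := (w - 2) / 3) (coefX2 (k := 5) isT)).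
by rewrite valI6; field: w2.
Qed.

(** Since w^3 = -1, the two terms of [coefX1] in h 3 combine to - t h 3 / 3, whence the cofactor
    -3. *)
Let th3E : t * h 3 = 6 * a 3 + (2 * w - 1) * 4 * (b 1 * b 2 - b 4 * b 5).
Proof.
have := coefX1 (k := 3) isT.
rewrite !big_I6 !valI6 /= !subI6 db3 h1E h2E h4E h5E => e.
by apply: (eq_of_multiple (c := - 3) e); field: w2.
Qed.

(** The summands with j = 3 or k - j = 3 contain h 3. The cofactor 18 t clears denominators and
    makes h 3 occur only as [t * h 3], which [th3E] replaces; the other three equations are obtained
    in the same way, with 6 t or 18 t. *)
Lemma ode_b1 :
  - 18 * t * db 1 =
    288 * b 1 * b 2 * b 4 * w - 2 * b 1 * t ^+ 2 * w - 24 * b 2 * b 5 * t * w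
    - 288 * b 4 ^+ 2 * b 5 * w + 18 * a 1 * t * w - 144 * b 1 * b 2 * b 4
    + b 1 * t ^+ 2 + 12 * b 2 * b 5 * t + 144 * b 4 ^+ 2 * b 5 - 18 * a 1 * t
    + 216 * a 3 * b 4.
Proof.
have := coefX1 (k := 1) isT.
rewrite !big_I6 !valI6 /= !subI6 b3 h1E h2E h4E h5E => e.
by apply: (eq_of_multiple (c := 18 * t) e); field: w2 th3E.
Qed.

Lemma ode_b2 :
  - 6 * t * db 2 =
    - 4 * b 1 ^+ 2 * t * w + 96 * b 1 * b 2 * b 5 * w - 2 * b 2 * t ^+ 2 * w
    + 12 * b 4 ^+ 2 * t * w - 96 * b 4 * b 5 ^+ 2 * w + 6 * a 2 * t * w
    + 2 * b 1 ^+ 2 * t - 48 * b 1 * b 2 * b 5 + b 2 * t ^+ 2 - 6 * b 4 ^+ 2 * t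
    + 48 * b 4 * b 5 ^+ 2 - 12 * a 2 * t + 72 * a 3 * b 5.
Proof.
have := coefX1 (k := 2) isT.
rewrite !big_I6 !valI6 /= !subI6 b3 h1E h2E h4E h5E => e.
by apply: (eq_of_multiple (c := 6 * t) e); field: w2 th3E.
Qed.

Lemma ode_b4 :
  - 6 * t * db 4 =
    96 * b 1 ^+ 2 * b 2 * w - 96 * b 1 * b 4 * b 5 * w - 12 * b 2 ^+ 2 * t * w
    + 2 * b 4 * t ^+ 2 * w + 4 * b 5 ^+ 2 * t * w - 6 * a 4 * t * w
    - 48 * b 1 ^+ 2 * b 2 + 48 * b 1 * b 4 * b 5 + 6 * b 2 ^+ 2 * t - b 4 * t ^+ 2
    - 2 * b 5 ^+ 2 * t + 72 * a 3 * b 1 - 6 * a 4 * t.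
Proof.
have := coefX1 (k := 4) isT.
rewrite !big_I6 !valI6 /= !subI6 b3 h1E h2E h4E h5E => e.
by apply: (eq_of_multiple (c := 6 * t) e); field: w2 th3E.
Qed.

Lemma ode_b5 :
  - 18 * t * db 5 =
    288 * b 1 * b 2 ^+ 2 * w + 24 * b 1 * b 4 * t * w - 288 * b 2 * b 4 * b 5 * w
    + 2 * b 5 * t ^+ 2 * w - 18 * a 5 * t * w - 144 * b 1 * b 2 ^+ 2
    - 12 * b 1 * b 4 * t + 144 * b 2 * b 4 * b 5 - b 5 * t ^+ 2 + 216 * a 3 * b 2.
Proof.
have := coefX1 (k := 5) isT.
rewrite !big_I6 !valI6 /= !subI6 b3 h1E h2E h4E h5E => e.
by apply: (eq_of_multiple (c := 18 * t) e); field: w2 th3E.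
Qed.

End Elimination.

(** * Coefficients of the compatibility condition *)

(* [L] stands for [laurent A] and [co n] for the coefficient of x^n; keeping them
   abstract prevents unification from unfolding the ring operations of [laurent A]. *)
Section CompatibilityCoefficients.
Variables (A L : comNzRingType) (co : int -> {additive L -> A}).
Variables (cst : A -> L) (x : L).
Implicit Types (u v p : A) (f : L) (n : int).
Hypothesis coef_cst : forall u n, co n (cst u) = if n == 0 then u else 0.
Hypothesis coef_X : forall n, co n x = if n == 1 then 1 else 0.
Hypothesis coef_cstM : forall u f n, co n (cst u * f) = u * co n f.
Hypothesis coef_XM : forall f n, co n (x * f) = co (n - 1) f.

(** Multiplication by x shifts the coefficients of 1 to those of x, which are known. *)
Let coef1 n : co n 1 = if n == 0 then 1 else 0.
Proof.
have -> : (n == 0) = (n + 1 == 1) by rewrite -[RHS]subr_eq0 addrK.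
by rewrite -coef_X -[x]mulr1 coef_XM addrK.
Qed.

Let coef_affM u v f n :
  co n ((cst u + cst v * x) * f) = u * co n f + v * co (n - 1) f.
Proof. by rewrite mulrDl -mulrA raddfD !coef_cstM coef_XM. Qed.

Let coef_aff u v n : co n (cst u + cst v * x) =
  (if n == 0 then u else 0) + (if n == 1 then v else 0).
Proof.
rewrite raddfD coef_cstM coef_cst coef_X.
by case: (n == 1); rewrite ?mulr1 ?mulr0.
Qed.

Let coef_quadM u v p f n :
  co n ((x ^+ 2 + cst u * cst v * x - cst p) * f) =
  co (n - 2) f + u * v * co (n - 1) f - p * co n f.
Proof.
have -> : (x ^+ 2 + cst u * cst v * x - cst p) * f =
    x * (x * f) + cst u * (cst v * (x * f)) - cst p * f.
  by rewrite mulrBl mulrDl expr2 -!mulrA.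
by rewrite raddfD raddfN raddfD !coef_cstM !coef_XM mulrA -[n - 1 - 1]addrA -opprD.
Qed.

Let coef_quad u v p n : co n (x ^+ 2 + cst u * cst v * x - cst p) =
  (if n == 2 then 1 else 0) + (if n == 1 then u * v else 0)
  - (if n == 0 then p else 0).
Proof.
rewrite -[X in co _ X]mulr1 coef_quadM !coef1 !subr_eq add0r.
by do 3![case: ifP => _]; rewrite ?mulr1 ?mulr0.
Qed.

(** [S i] stands for the i-th iterate of the ring automorphism x -> w x, [W n] for w^n, and [z n]
    for n / 6, the eigenvalue of z d/dz on x^n. *)
Variables (S : nat -> L -> L) (W z : int -> A) (dz dt : L -> L) (d : A -> A).
Hypothesis coef_S : forall i f n, co n (S i f) = W n ^+ i * co n f.
Hypothesis W0 : W 0 = 1.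
Hypothesis coef_dz : forall f n, co n (dz f) = z n * co n f.
Hypothesis coef_dt : forall f n, co n (dt f) = d (co n f).
Hypothesis d0 : d 0 = 0.
Variables (c c' t : A) (a b h : 'I_6 -> A) (k : 'I_6).
Hypothesis compatible :
  dz (cst (h k)) + (x * (cst (a k) + cst (b k) * x)
   + (cst (h k) * S k (x ^+ 2 + cst c * cst t * x - cst c')
   + \sum_(j < 6 | (j != 0) && (j != k))
       cst (h j) * S j (cst (a (k - j)) + cst (b (k - j)) * x)))
  = dt (cst (a k) + cst (b k) * x)
   + ((x ^+ 2 + cst c * cst t * x - cst c') * cst (h k)
   + ((cst (a k) + cst (b k) * x) * S k x
   + \sum_(j < 6 | (j != 0) && (j != k))
       (cst (a j) + cst (b j) * x) * S j (cst (h (k - j))))).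

Lemma compatible_coefX2 : b k + h k * W 2 ^+ k = h k + b k * W 1 ^+ k.
Proof.
have /(congr1 (co 2)) := compatible.
rewrite !raddfD !raddf_sum coef_dz coef_dt coef_XM coef_cstM coef_quadM coef_affM.
rewrite !coef_S coef_quad !coef_aff !coef_cst !coef_X /=.
(* Each summand has degree at most 1 in x, so both sums vanish here. *)
rewrite !big1 => [|j _|j _]; last 2 first.
- by rewrite coef_affM !coef_S !coef_cst /= !mulr0 addr0.
- by rewrite coef_cstM coef_S coef_aff /= addr0 !mulr0.
by rewrite [0 + 0]addr0 d0 !(mulr0, mulr1, addr0, add0r, subr0).
Qed.

Lemma compatible_coefX1 :
  a k + h k * (W 1 ^+ k * (c * t))
    + \sum_(j < 6 | (j != 0) && (j != k)) h j * (W 1 ^+ j * b (k - j))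
  = d (b k) + c * t * h k + a k * W 1 ^+ k
    + \sum_(j < 6 | (j != 0) && (j != k)) b j * h (k - j).
Proof.
have /(congr1 (co 1)) := compatible.
rewrite !raddfD !raddf_sum coef_dz coef_dt coef_XM coef_cstM coef_quadM coef_affM.
rewrite !coef_S coef_quad !coef_aff !coef_cst !coef_X /=.
under eq_bigr => j _ do rewrite coef_cstM coef_S coef_aff /= add0r.
under [in RHS]eq_bigr => j _
  do rewrite coef_affM !coef_S !coef_cst /= W0 !mulr0 add0r expr1n mul1r.
by rewrite !(mulr0, mulr1, addr0, add0r, subr0) !addrA.
Qed.

End CompatibilityCoefficients.

(** * Laurent polynomials and equivariant operators *)

Section LaurentCoefficients.
Variable A : comNzRingType.
Implicit Types (f : laurent A) (c : A) (n k : int).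

(** A named map, so that it can carry the additive structure required of [co]. *)
Definition laurent_coef k f : A := f k.

Fact laurent_coef_additive k : nmod_morphism (laurent_coef k).
Proof. by split=> //; rewrite /laurent_coef /= /lmono if_same. Qed.
HB.instance Definition _ k :=
  GRing.isNmodMorphism.Build _ _ (laurent_coef k) (laurent_coef_additive k).

Lemma laurent_monoM c n f k :
  laurent_coef k (laurent_mono c n * f) = c * laurent_coef (k - n) f.
Proof.
rewrite /laurent_coef [LHS]/= /lconv -(@fsbig_widen _ _ _ _ [set n]) //; last first.
  by move=> i /= [_ /eqP]; rewrite /lmono => /negPf ->; rewrite mul0r.
by rewrite fsbig_set1 /lmono eqxx.
Qed.

End LaurentCoefficients.

(** * Evaluation of analytic functions at a point of the domain *)

Section Evaluation.
Variables (R : realType) (U : domain R) (s : Cplx R) (Us : domain_set U s).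

(* The membership proof is an argument, as evaluation at points outside [U] does
   not preserve 1. *)
Definition anfun_eval (_ : domain_set U s) (f : anfun U) : Cplx R := f s.

Fact anfun_eval_additive : nmod_morphism (anfun_eval Us).
Proof. by split=> [|f g]; apply: restr_anfunE. Qed.
Fact anfun_eval_multiplicative : monoid_morphism (anfun_eval Us).
Proof. by split=> [|f g]; apply: restr_anfunE. Qed.
HB.instance Definition _ :=
  GRing.isNmodMorphism.Build _ _ (anfun_eval Us) anfun_eval_additive.
HB.instance Definition _ :=
  GRing.isMonoidMorphism.Build _ _ (anfun_eval Us) anfun_eval_multiplicative.

Lemma anfun_eval_cst c : anfun_eval Us (cst_anfun U c) = c.
Proof. exact: restr_anfunE. Qed.

Lemma anfun_eval_var : anfun_eval Us (var_anfun U) = s.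
Proof. exact: restr_anfunE. Qed.

Lemma anfun_eval_derive f : anfun_eval Us (derive_anfun f) = derive1 f s.
Proof. exact: restr_anfunE. Qed.

End Evaluation.

Arguments anfun_eval : simpl never.

Section EquivariantOperators.
Variables (R : realType) (U : domain R).
Notation L := (laurent (anfun U)).
Notation lsigma := (@laurent_sigma R U).

Lemma laurent_sigma0 : lsigma 0 = 0.
Proof. by apply: laurent_eqP => k; rewrite /= /lmono if_same mulr0. Qed.

Lemma laurent_sigma1 : lsigma 1 = 1.
Proof.
apply: laurent_eqP => k.
change (cst_anfun U (w6 R ^ k) * (if k == 0 then 1 else 0) = if k == 0 then 1 else 0).
by case: eqP => [->|_]; rewrite ?mulr0 ?mulr1 ?expr0z.
Qed.

Lemma coef_iter_laurent_sigma i (f : L) k :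
  laurent_coef k (iter i lsigma f) = cst_anfun U (w6 R ^ k) ^+ i * laurent_coef k f.
Proof.
elim: i => [|i IH]; first by rewrite mul1r.
by rewrite exprS -mulrA -IH.
Qed.

Lemma sigmaE (m : 'rV[L]_6) k : sigma m 0 k = lsigma (m 0 (k - 1)).
Proof.
rewrite summxE (bigD1 (k - 1)) //= subrK big1 ?addr0 => [|i ik].
  by rewrite !mxE !eqxx mulr1.
by rewrite !mxE eqxx /= -subr_eq eq_sym (negPf ik) mulr0.
Qed.

Lemma sigma_basis j : sigma (basis_e U j) = basis_e U (j + 1).
Proof.
apply/rowP => k; rewrite sigmaE !mxE eqxx /= subr_eq.
by case: eqP; rewrite ?laurent_sigma1 ?laurent_sigma0.
Qed.

Lemma iter_sigmaE i (m : 'rV[L]_6) k :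
  iter i (@sigma R U) m 0 k = iter i lsigma (m 0 (k - i%:R)).
Proof.
elim: i k => [|i IH] k; first by rewrite subr0.
by rewrite !iterS sigmaE IH -natr1 opprD addrA addrAC.
Qed.

Variables (d : L -> L) (D : 'rV[L]_6 -> 'rV[L]_6).
Hypothesis dD : equivariant_derivation d D.

(** e_j is the j-th [sigma]-iterate of e_0 and D commutes with [sigma]; each application shifts
    coordinates by one and applies the automorphism of L. *)
Lemma derivation_basis j k :
  D (basis_e U j) 0 k = iter j lsigma (D (basis_e U 0) 0 (k - j)).
Proof.
have [DD Dl Ds] := dD.
have -> : basis_e U j = iter j (@sigma R U) (basis_e U 0).
  (* Writing j as the image of a natural number allows induction on the latter, while addition of 1
     stays modulo 6. *)
  rewrite -[in LHS](natr_Zp j).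
  elim: (j : nat) => [|i IH]; first by [].
  by rewrite iterS -IH sigma_basis natr1.
have -> : D (iter j (@sigma R U) (basis_e U 0)) =
    iter j (@sigma R U) (D (basis_e U 0)).
  by elim: (j : nat) => //= i IH; rewrite Ds IH.
by rewrite iter_sigmaE natr_Zp.
Qed.

(** Expand m in the basis and apply the Leibniz rule; among the terms d (m_j) e_j only j = k reaches
    coordinate k. *)
Lemma derivation_coord m k : D m 0 k =
  d (m 0 k) + \sum_j m 0 j * iter j lsigma (D (basis_e U 0) 0 (k - j)).
Proof.
have [DD Dl Ds] := dD.
have D0 : D 0 = 0 by apply: (addrI (D 0)); rewrite -DD !addr0.
rewrite {1}[m]row_sum_delta (big_morph D DD D0) summxE.
transitivity (\sum_j (d (m 0 j) * basis_e U j 0 k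
    + m 0 j * iter j lsigma (D (basis_e U 0) 0 (k - j)))).
  by apply: eq_bigr => j _; rewrite Dl -derivation_basis !mxE.
rewrite big_split /= (bigD1 k) //= big1 ?addr0 => [|i ik].
  by rewrite !mxE !eqxx mulr1.
by rewrite !mxE eqxx eq_sym (negPf ik) mulr0.
Qed.

Lemma basis_combination_coord (p : L) (q : 'I_6 -> L) k :
  (p *: basis_e U 0 + \sum_(j < 6 | j != 0) q j *: basis_e U j) 0 k =
  if k == 0 then p else q k.
Proof.
rewrite mxE summxE; case: (eqVneq k 0) => [->|k0].
  rewrite big1 ?addr0 => [|j j0]; first by rewrite !mxE !eqxx mulr1.
  by rewrite !mxE eqxx eq_sym (negPf j0) mulr0.
rewrite (bigD1 k) //= big1 ?addr0 => [|j /andP[_ jk]].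
  by rewrite !mxE !eqxx (negPf k0) mulr0 mulr1 add0r.
by rewrite !mxE eqxx eq_sym (negPf jk) mulr0.
Qed.

End EquivariantOperators.

(** * The compatibility condition, first by coordinates, then at a point of the domain *)

Section Compatibility.
Variables (R : realType) (U : domain R).
Variables (a : 'I_6 -> Cplx R) (b h : 'I_6 -> anfun U).
Notation L := (laurent (anfun U)).
Notation A := (anfun U).
Notation cst c := (laurent_cst (cst_anfun U c)).
Notation x := (laurent_X U).
Notation t := (laurent_cst (var_anfun U)).
Notation e := (@basis_e R U).
Notation lsigma := (@laurent_sigma R U).
Variables (D E : 'rV[L]_6 -> 'rV[L]_6).
Hypothesis dD : equivariant_derivation (@laurent_zddz R U) D.
Hypothesis dE : equivariant_derivation (@laurent_ddt R U) E.
Hypothesis De0 :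
  D (e 0) = (x ^+ 2 + cst (1 / 6) * t * x - cst (5 / 12)) *: e 0
    + \sum_(j < 6 | j != 0) (cst (a j) + laurent_cst (b j) * x) *: e j.
Hypothesis Ee0 :
  E (e 0) = x *: e 0 + \sum_(j < 6 | j != 0) laurent_cst (h j) *: e j.
Hypothesis DE : D (E (e 0)) = E (D (e 0)).

Lemma compatible_coord (k : 'I_6) : k != 0 ->
  laurent_zddz (laurent_cst (h k)) + (x * (cst (a k) + laurent_cst (b k) * x)
   + (laurent_cst (h k)
        * iter k lsigma (x ^+ 2 + cst (1 / 6) * t * x - cst (5 / 12))
   + \sum_(j < 6 | (j != 0) && (j != k)) laurent_cst (h j)
        * iter j lsigma (cst (a (k - j)) + laurent_cst (b (k - j)) * x)))
  = laurent_ddt (cst (a k) + laurent_cst (b k) * x)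
   + ((x ^+ 2 + cst (1 / 6) * t * x - cst (5 / 12)) * laurent_cst (h k)
   + ((cst (a k) + laurent_cst (b k) * x) * iter k lsigma x
   + \sum_(j < 6 | (j != 0) && (j != k)) (cst (a j) + laurent_cst (b j) * x)
        * iter j lsigma (laurent_cst (h (k - j))))).
Proof.
have E0 : E (e 0) 0 0 = x by rewrite Ee0 basis_combination_coord.
have D0 : D (e 0) 0 0 = x ^+ 2 + cst (1 / 6) * t * x - cst (5 / 12).
  by rewrite De0 basis_combination_coord.
have Ej (j : 'I_6) : j != 0 -> E (e 0) 0 j = laurent_cst (h j).
  by rewrite Ee0 basis_combination_coord => /negPf ->.
have Dj (j : 'I_6) : j != 0 -> D (e 0) 0 j = cst (a j) + laurent_cst (b j) * x.
  by rewrite De0 basis_combination_coord => /negPf ->.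
move=> k0; have := congr1 (fun m : 'rV__ => m 0 k) DE.
rewrite /= (derivation_coord dD (E (e 0))) (derivation_coord dE (D (e 0))).
(* The terms j = 0 and j = k are split off because they involve the e_0-coordinates of D(e_0) and
   E(e_0); for all other j, both j and k - j are nonzero. *)
rewrite Ej // Dj // (bigD1 0) //= (bigD1 k) //=.
rewrite [in RHS](bigD1 0) //= [in RHS](bigD1 k) //=.
rewrite !subr0 !subrr !E0 !D0 !(Ej k k0) !(Dj k k0).
congr (_ + (_ + (_ + _)) = _ + (_ + (_ + _))); apply: eq_bigr => j /andP[j0 jk].
  by rewrite Ej // Dj // subr_eq0 eq_sym.
by rewrite Ej ?Dj // subr_eq0 eq_sym.
Qed.

Let coef_cst (c : A) n :
  laurent_coef n (laurent_cst c) = if n == 0 then c else 0.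
Proof. by []. Qed.

Let coef_X n : laurent_coef n x = if n == 1 then 1 else 0.
Proof. by []. Qed.

Let coef_cstM (c : A) f n :
  laurent_coef n (laurent_cst c * f) = c * laurent_coef n f.
Proof. by rewrite laurent_monoM subr0. Qed.

Let coef_XM f n : laurent_coef n (x * f) = laurent_coef (n - 1) f.
Proof. by rewrite laurent_monoM mul1r. Qed.

Let coef_zddz (f : L) n : laurent_coef n (laurent_zddz f) =
  cst_anfun U (n%:~R / 6) * laurent_coef n f.
Proof. by []. Qed.

Let coef_ddt (f : L) n :
  laurent_coef n (laurent_ddt f) = derive_anfun (laurent_coef n f).
Proof. by []. Qed.

Variables (s : Cplx R) (Us : domain_set U s).

Lemma compatible_evalX2 (k : 'I_6) : k != 0 ->
  b k s + h k s * (w6 R ^+ 2) ^+ k = h k s + b k s * w6 R ^+ k.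
Proof.
move=> k0.
have := compatible_coefX2 (co := fun n => @laurent_coef A n) coef_cst coef_X
  coef_cstM coef_XM (@coef_iter_laurent_sigma R U) coef_zddz coef_ddt
  (derive_anfun0 U) (compatible_coord k0).
move=> /(congr1 (anfun_eval Us)).
by rewrite !(rmorphD, rmorphM, rmorphXn) /= !anfun_eval_cst.
Qed.

Lemma compatible_evalX1 (k : 'I_6) : k != 0 ->
  a k + h k s * (w6 R ^+ k * (1 / 6 * s))
    + \sum_(j < 6 | (j != 0) && (j != k)) h j s * (w6 R ^+ j * b (k - j) s)
  = anfun_eval Us (derive_anfun (b k)) + 1 / 6 * s * h k s + a k * w6 R ^+ k
    + \sum_(j < 6 | (j != 0) && (j != k)) b j s * h (k - j) s.
Proof.
move=> k0.
(* Here [erefl] proves [W 0 = 1], as w^0 computes to 1. *)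
have := compatible_coefX1 (co := fun n => @laurent_coef A n) coef_cst coef_X
  coef_cstM coef_XM (@coef_iter_laurent_sigma R U) erefl coef_zddz coef_ddt
  (compatible_coord k0).
move=> /(congr1 (anfun_eval Us)).
rewrite !(rmorphD, rmorphM, rmorphXn, rmorph_sum) /= !anfun_eval_cst anfun_eval_var.
under eq_bigr => j _ do rewrite !(rmorphM, rmorphXn) /= anfun_eval_cst.
by under [in RHS]eq_bigr => j _ do rewrite rmorphM.
Qed.

Lemma compatible_ode_system : b 3 = 0 ->
  ode_system (a 1) (a 2) (a 3) (a 4) (a 5) (b 1) (b 2) (b 4) (b 5) s.
Proof.
(* With the point s fixed, the elimination treats the values of b, h and the derivatives of b as
   separate families of numbers. *)
move=> b3; pose B j := anfun_eval Us (b j); pose H j := anfun_eval Us (h j).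
pose dB j := anfun_eval Us (derive_anfun (b j)).
have B3 : B 3 = 0 by rewrite /B b3 rmorph0.
have dB3 : dB 3 = 0 by rewrite /dB b3 derive_anfun0 rmorph0.
have X2 (k : 'I_6) : k != 0 -> B k + H k * (w6 R ^+ 2) ^+ k = H k + B k * w6 R ^+ k.
  exact: compatible_evalX2.
have X1 := compatible_evalX1.
rewrite /ode_system -!(anfun_eval_derive Us).
split.
- exact: (ode_b1 (b := B) (h := H) (db := dB) (w6_sqr R) B3 dB3 X2 X1).
- exact: (ode_b2 (b := B) (h := H) (db := dB) (w6_sqr R) B3 dB3 X2 X1).
- exact: (ode_b4 (b := B) (h := H) (db := dB) (w6_sqr R) B3 dB3 X2 X1).
- exact: (ode_b5 (b := B) (h := H) (db := dB) (w6_sqr R) B3 dB3 X2 X1).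
Qed.

End Compatibility.

(** * The Hamiltonian *)

(** With the constant term written as [f 0], only the three higher coefficients have to be
    supplied. *)
Lemma derive1_cubic (K : numFieldType) (f : K -> K) (c1 c2 c3 x : K) :
  (forall y, f y = f 0 + c1 * y + c2 * y ^+ 2 + c3 * y ^+ 3) ->
  derive1 f x = c1 + 2 * c2 * x + 3 * c3 * x ^+ 2.
Proof.
move=> /funext ->; rewrite derive1E; apply: derive_val.
by apply: is_derive_eq; rewrite /GRing.scale /=; ring.
Qed.

Section Hamiltonian.
Variables (R : realType) (a1 a2 a3 a4 a5 t : Cplx R).
Hypothesis t0 : t != 0.
Notation w := (w6 R).
Notation H := (hamiltonian a1 a2 a3 a4 a5 t).

(** The explicit arguments of [derive1_cubic] are the coefficients of b5, b5^2 and b5^3 in H, the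
    last being 0. The factor -18 t yields the right-hand side of the equation for b1. *)
Lemma derive1_hamiltonian_b5 b1 b2 b4 b5 :
  - 18 * t * (derive1 (fun y => H b1 b2 b4 y) b5) =
  288 * b1 * b2 * b4 * w - 2 * b1 * t ^+ 2 * w - 24 * b2 * b5 * t * w
    - 288 * b4 ^+ 2 * b5 * w + 18 * a1 * t * w - 144 * b1 * b2 * b4
    + b1 * t ^+ 2 + 12 * b2 * b5 * t + 144 * b4 ^+ 2 * b5 - 18 * a1 * t
    + 216 * a3 * b4.
Proof.
rewrite (@derive1_cubic _ _
  (((w - 1 / 2) * (b1 / 3) * t ^+ 2 + (3 * a1 - 3 * a1 * w) * t
    + 12 * (b4 * (- b1 * (2 * w - 1) * b2 - 3 * a3) - b1 * b2 * (2 * w - 1) * b4)) / (3 * t))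
  (((2 * w - 1) * (b2 * t + 12 * b4 ^+ 2)) / (3 * t)) 0).
  by field.
by move=> y; rewrite /hamiltonian; field.
Qed.

Lemma derive1_hamiltonian_b4 b1 b2 b4 b5 :
  - 6 * t * (derive1 (fun y => H b1 b2 y b5) b4) =
  - 4 * b1 ^+ 2 * t * w + 96 * b1 * b2 * b5 * w - 2 * b2 * t ^+ 2 * w
    + 12 * b4 ^+ 2 * t * w - 96 * b4 * b5 ^+ 2 * w + 6 * a2 * t * w
    + 2 * b1 ^+ 2 * t - 48 * b1 * b2 * b5 + b2 * t ^+ 2 - 6 * b4 ^+ 2 * t
    + 48 * b4 * b5 ^+ 2 - 12 * a2 * t + 72 * a3 * b5.
Proof.
rewrite (@derive1_cubic _ _
  (((w - 1 / 2) * b2 * t ^+ 2 + ((2 * w - 1) * b1 ^+ 2 - 3 * a2 * w + 6 * a2) * t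
    + 12 * (b5 * (- b1 * (2 * w - 1) * b2 - 3 * a3) - (2 * w - 1) * b1 * b2 * b5)) / (3 * t))
  ((12 * (2 * w - 1) * b5 ^+ 2) / (3 * t)) (((1 - 2 * w) * t) / (3 * t))).
  by field.
by move=> y; rewrite /hamiltonian; field.
Qed.

(** The inner minus sign is that of the Hamilton equation for b4; likewise for b1 and b5 below. *)
Lemma derive1_hamiltonian_b2 b1 b2 b4 b5 :
  - 6 * t * (- derive1 (fun y => H b1 y b4 b5) b2) =
  96 * b1 ^+ 2 * b2 * w - 96 * b1 * b4 * b5 * w - 12 * b2 ^+ 2 * t * w
    + 2 * b4 * t ^+ 2 * w + 4 * b5 ^+ 2 * t * w - 6 * a4 * t * w
    - 48 * b1 ^+ 2 * b2 + 48 * b1 * b4 * b5 + 6 * b2 ^+ 2 * t - b4 * t ^+ 2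
    - 2 * b5 ^+ 2 * t + 72 * a3 * b1 - 6 * a4 * t.
Proof.
rewrite (@derive1_cubic _ _
  (((w - 1 / 2) * b4 * t ^+ 2 + ((2 * w - 1) * b5 ^+ 2 - 3 * a4 * w - 3 * a4) * t
    - 12 * (b1 * (b5 * (2 * w - 1) * b4 - 3 * a3) + (2 * w - 1) * b1 * b4 * b5)) / (3 * t))
  ((12 * (2 * w - 1) * b1 ^+ 2) / (3 * t)) (((1 - 2 * w) * t) / (3 * t))).
  by field.
by move=> y; rewrite /hamiltonian; field.
Qed.

Lemma derive1_hamiltonian_b1 b1 b2 b4 b5 :
  - 18 * t * (- derive1 (fun y => H y b2 b4 b5) b1) =
  288 * b1 * b2 ^+ 2 * w + 24 * b1 * b4 * t * w - 288 * b2 * b4 * b5 * w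
    + 2 * b5 * t ^+ 2 * w - 18 * a5 * t * w - 144 * b1 * b2 ^+ 2
    - 12 * b1 * b4 * t + 144 * b2 * b4 * b5 - b5 * t ^+ 2 + 216 * a3 * b2.
Proof.
rewrite (@derive1_cubic _ _
  (((w - 1 / 2) * (b5 / 3) * t ^+ 2 - 3 * a5 * w * t
    - 12 * (b2 * (b5 * (2 * w - 1) * b4 - 3 * a3) + (2 * w - 1) * b2 * b4 * b5)) / (3 * t))
  (((2 * w - 1) * (b4 * t + 12 * b2 ^+ 2)) / (3 * t)) 0).
  by field.
by move=> y; rewrite /hamiltonian; field.
Qed.

Lemma ode_system_hamilton (b1 b2 b4 b5 : Cplx R -> Cplx R) :
  ode_system a1 a2 a3 a4 a5 b1 b2 b4 b5 t <->
  hamilton_equations a1 a2 a3 a4 a5 b1 b2 b4 b5 t.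
Proof.
have n18 : - 18 * t != 0 by rewrite mulf_neq0 // oppr_eq0 pnatr_eq0.
have n6 : - 6 * t != 0 by rewrite mulf_neq0 // oppr_eq0 pnatr_eq0.
have e1 := mulf_eq_iff (derive1 b1 t) n18
  (derive1_hamiltonian_b5 (b1 t) (b2 t) (b4 t) (b5 t)).
have e2 := mulf_eq_iff (derive1 b2 t) n6
  (derive1_hamiltonian_b4 (b1 t) (b2 t) (b4 t) (b5 t)).
have e4 := mulf_eq_iff (derive1 b4 t) n6
  (derive1_hamiltonian_b2 (b1 t) (b2 t) (b4 t) (b5 t)).
have e5 := mulf_eq_iff (derive1 b5 t) n18
  (derive1_hamiltonian_b1 (b1 t) (b2 t) (b4 t) (b5 t)).
(* The two systems list their equations in different orders: b1, b2, b4, b5 against b5, b1, b4,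
   b2. *)
split=> -[f1 f2 f3 f4]; split.
- exact: (iffLR e5 f4).
- exact: (iffLR e1 f1).
- exact: (iffLR e4 f3).
- exact: (iffLR e2 f2).
- exact: (iffRL e1 f2).
- exact: (iffRL e2 f4).
- exact: (iffRL e4 f3).
- exact: (iffRL e5 f1).
Qed.

End Hamiltonian.

Theorem mainTheorem11 (R : realType) (U : domain R) (a : 'I_6 -> Cplx R)
    (b h : 'I_6 -> anfun U) (hb3 : b 3 = 0) :
  (forall D E : 'rV[laurent (anfun U)]_6 -> 'rV[laurent (anfun U)]_6,
     let cst c := laurent_cst (cst_anfun U c) in
     let t := laurent_cst (var_anfun U) in
     let x := laurent_X U in
     let e := @basis_e R U in
     equivariant_derivation (@laurent_zddz R U) D ->
     equivariant_derivation (@laurent_ddt R U) E ->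
     D (e 0) = (x ^+ 2 + cst (1 / 6) * t * x - cst (5 / 12)) *: e 0
       + \sum_(j < 6 | j != 0) (cst (a j) + laurent_cst (b j) * x) *: e j ->
     E (e 0) = x *: e 0 + \sum_(j < 6 | j != 0) laurent_cst (h j) *: e j ->
     D (E (e 0)) = E (D (e 0)) ->
     forall s, domain_set U s ->
       ode_system (a 1) (a 2) (a 3) (a 4) (a 5) (b 1) (b 2) (b 4) (b 5) s) /\
  (forall s, domain_set U s ->
     ode_system (a 1) (a 2) (a 3) (a 4) (a 5) (b 1) (b 2) (b 4) (b 5) s <->
     hamilton_equations (a 1) (a 2) (a 3) (a 4) (a 5) (b 1) (b 2) (b 4) (b 5) s).
Proof.
split=> [D E cst t x e dD dE De0 Ee0 DE s Us | s Us].
  exact: (compatible_ode_system dD dE De0 Ee0 DE Us hb3).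
(* The domain omits 0, so the division by 3t in H is legitimate at s. *)
apply: ode_system_hamilton; apply/eqP => s0.
by apply: (@domain_neq0 _ U); rewrite -s0.
Qed.
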